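(* Let $m\ge 1$ be an integer, let $\kappa_1,\kappa_2\geq 0$ be real numbers and let $D>0$. Let $\bar{\mu}_1(m,\kappa_1,\kappa_2,D)$ be the first nonzero Neumann eigenvalue of the one-dimensional eigenvalue problem $$\varphi''-\left(2(m-1)T_{\kappa_2}+T_{4\kappa_1}\right)\varphi'=-\lambda\varphi$$ on $[-D/2,D/2]$. Then $$\bar{\mu}_1(m,\kappa_1,\kappa_2,D)\geq \sup_{s\in(0,1)}\left(4s(1-s)\frac{\pi^2}{D^2}+2s(m-1)\kappa_2+4s\kappa_1\right).$$
   Context: For $\kappa\geq0$: $T_\kappa(t)=\sqrt{\kappa}\tan(\sqrt{\kappa}\,t)$ if $\kappa>0$, and $T_0(t)=0$. The Neumann condition is $\varphi'(-D/2)=\varphi'(D/2)=0$. The number $D$ is such that the coefficient $2(m-1)T_{\kappa_2}+T_{4\kappa_1}$ is finite on $[-D/2,D/2]$, so that the eigenvalue problem makes sense. *)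

(* Defs.v *)
From Stdlib Require Import Reals.
From Coquelicot Require Import Coquelicot.
Open Scope R_scope.

(* The value of [T k] is only meaningful away from the poles of the tangent,
   see [T_finite]. *)
Definition T (k t : R) : R :=
  if Rlt_dec 0 k then sqrt k * tan (sqrt k * t) else 0.

(* [tan] is total ([sin / cos]), so the absence of a pole of [T k] at [t] has
   to be expressed through its denominator. *)
Definition T_finite (k t : R) : Prop := 0 < k -> cos (sqrt k * t) <> 0.

Definition drift (m : nat) (k1 k2 t : R) : R :=
  2 * (INR m - 1) * T k2 t + T (4 * k1) t.

Definition interval (D t : R) : Prop := - D / 2 <= t <= D / 2.

(* For [m = 1] the term [T k2] does not occur in the coefficient.  For [m > 1]
   the two terms cannot compensate: at the common pole closest to 0 both
   tend to infinity with the same sign. *)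
Definition drift_finite (m : nat) (k1 k2 D : R) : Prop :=
  forall t, interval D t ->
    ((1 < m)%nat -> T_finite k2 t) /\ T_finite (4 * k1) t.

(* [D_in f f' (interval D) t] is differentiability relative to the closed
   interval, hence one-sided at the end points.  The continuity of [phi2]
   follows from the equation. *)
Definition neumann_eigenfunction
    (m : nat) (k1 k2 D lambda : R) (phi : R -> R) : Prop :=
  exists phi1 phi2 : R -> R,
    (forall t, interval D t ->
       D_in phi phi1 (interval D) t /\
       D_in phi1 phi2 (interval D) t /\
       phi2 t - drift m k1 k2 t * phi1 t = - lambda * phi t) /\
    phi1 (- D / 2) = 0 /\ phi1 (D / 2) = 0 /\
    (exists t, interval D t /\ phi t <> 0).

Definition neumann_eigenvalue (m : nat) (k1 k2 D lambda : R) : Prop :=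
  exists phi : R -> R, neumann_eigenfunction m k1 k2 D lambda phi.

Definition first_nonzero_neumann_eigenvalue
    (m : nat) (k1 k2 D mu : R) : Prop :=
  (mu <> 0 /\ neumann_eigenvalue m k1 k2 D mu) /\
  forall lambda, lambda <> 0 -> neumann_eigenvalue m k1 k2 D lambda ->
    mu <= lambda.

(* Main.v *)
Require Import Defs.
From Stdlib Require Import Reals Lra Lia.
From Coquelicot Require Import Coquelicot.
Open Scope R_scope.

(** Write [a] for the drift.  Differentiating the equation, [psi = phi']
    satisfies [psi'' - a psi' - a' psi + lambda psi = 0] and vanishes at both
    end points, and it is not identically zero because [lambda <> 0].  The proof
    compares [psi] with a positive strict supersolution [exp H] of this
    Dirichlet problem: if one exists, then [psi * exp (- H)] cannot have a
    positive interior maximum, and applying this to [psi] and [- psi] gives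
    [psi = 0], a contradiction ([derivative_nonpos_of_riccati]).  In terms of
    [h = H'], being a strict supersolution is the Riccati inequality
    [h' + h^2 - a h - a' + lambda < 0].

    For [0 < w < PI / D], [0 < s < 1] and [r = 4 s (1 - s)], the choice
    [exp H = exp ((1 - s) A) * cos (w t) ^ r] with [A' = a] works as soon as
    [lambda < r w^2 + s a'].  Indeed, with [x = w tan (w t)] and
    [h = (1 - s) a - r x], the left-hand side of the Riccati inequality equals
    [lambda - s a' - r w^2 - s (1 - s) (a + 2 (1 - 2 s) x)^2].
    The exponent [r] is forced: the constant terms match only for
    [r = 4 s (1 - s)], and for this value the remaining quadratic form in [a]
    and [x] happens to be a perfect square ([neumann_eigenvalue_ge]).

    Since [T k] has derivative [k + (T k)^2], the drift satisfies
    [a' >= 2 (m - 1) k2 + 4 k1].  Letting [w] tend to [PI / D] gives the bound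
    for each [s], for every nonzero eigenvalue, hence for the first one. *)

(** * Differentiability relative to a closed interval *)

Lemma D_in_is_derive (D : R) (f f' : R -> R) (t : R) :
  - D / 2 < t < D / 2 -> D_in f f' (interval D) t -> is_derive f t (f' t).
Proof.
  intros ht hf.
  apply is_derive_Reals; intros eps heps.
  destruct (hf eps heps) as [del [hdel hlim]].
  assert (hpos : 0 < Rmin del (Rmin (t - - D / 2) (D / 2 - t))).
  { repeat apply Rmin_glb_lt; lra. }
  exists (mkposreal _ hpos); intros h hh0 hh; simpl in hh.
  assert (hh1 : Rabs h < del) by (eapply Rlt_le_trans; [exact hh | apply Rmin_l]).
  assert (hh2 : Rabs h < Rmin (t - - D / 2) (D / 2 - t))
    by (eapply Rlt_le_trans; [exact hh | apply Rmin_r]).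
  assert (hh3 : Rabs h < t - - D / 2)
    by (eapply Rlt_le_trans; [exact hh2 | apply Rmin_l]).
  assert (hh4 : Rabs h < D / 2 - t)
    by (eapply Rlt_le_trans; [exact hh2 | apply Rmin_r]).
  apply Rabs_def2 in hh3; apply Rabs_def2 in hh4.
  specialize (hlim (t + h)).
  simpl in hlim; unfold Rdist in hlim.
  replace (t + h - t) with h in hlim by ring.
  apply hlim; split; [| exact hh1].
  split; [unfold interval; lra | lra].
Qed.

(** Composing with the retraction of the line onto the interval turns one-sided
    continuity at the end points into ordinary continuity, which the
    extreme value theorem for [continuity_pt] asks for. *)
Definition clamp (D t : R) : R := Rmax (- D / 2) (Rmin t (D / 2)).

Lemma clamp_id (D t : R) : interval D t -> clamp D t = t.
Proof.
  unfold interval, clamp; intros ht.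
  rewrite Rmin_left, Rmax_right; lra.
Qed.

Lemma D_in_continuity_clamp (D : R) (f f' : R -> R) (t : R) :
  interval D t -> D_in f f' (interval D) t ->
  continuity_pt (fun x => f (clamp D x)) t.
Proof.
  intros ht hf eps heps.
  destruct (cont_deriv _ _ _ _ hf eps heps) as [del [hdel hlim]].
  exists del; split; [exact hdel |].
  intros x [_ hx]; rewrite (clamp_id D t ht).
  simpl in hx |- *; unfold Rdist in hx |- *.
  (* [D_x] excludes the base point, so the case [clamp D x = t] is separate. *)
  destruct (Req_dec t (clamp D x)) as [e | ne].
  - rewrite <- e, Rminus_diag, Rabs_R0; exact heps.
  - apply (hlim (clamp D x)); split.
    + split; [| exact ne].
      unfold interval, clamp in *; split; [apply Rmax_l |].
      apply Rmax_lub; [lra | apply Rmin_r].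
    + simpl; unfold Rdist; revert hx; unfold clamp, interval in *.
      unfold Rmin; destruct (Rle_dec x (D / 2)); unfold Rmax;
        destruct (Rle_dec _ _); unfold Rabs;
        repeat destruct (Rcase_abs _); lra.
Qed.

(** A derivative relative to the interval is unique because every point of the
    interval, end points included, is a limit of other points of it. *)
Lemma D_in_zero (D : R) (f f' : R -> R) (t : R) :
  0 < D -> interval D t -> (forall x, interval D x -> f x = 0) ->
  D_in f f' (interval D) t -> f' t = 0.
Proof.
  intros hD ht hf0 hf.
  apply (single_limit (fun x => (f x - f t) / (x - t))
           (D_x (interval D) t) (f' t) 0 t); [| exact hf |].
  - intros alp halp.
    set (d := Rmin (alp / 2) (D / 2)).
    assert (hd : 0 < d) by (apply Rmin_glb_lt; lra).
    assert (hd1 : d <= alp / 2) by apply Rmin_l.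
    assert (hd2 : d <= D / 2) by apply Rmin_r.
    unfold interval in ht.
    (* Step towards the centre, so as to stay inside the interval. *)
    destruct (Rle_dec t 0) as [hl | hg].
    + exists (t + d); split.
      * split; [unfold interval; lra | lra].
      * unfold Rdist; apply Rabs_def1; lra.
    + exists (t - d); split.
      * split; [unfold interval; lra | lra].
      * unfold Rdist; apply Rabs_def1; lra.
  - intros eps heps; exists 1; split; [lra |].
    intros x [[hx _] _]; simpl; unfold Rdist.
    rewrite (hf0 x hx), (hf0 t ht).
    replace ((0 - 0) / (x - t) - 0) with 0 by (unfold Rdiv; ring).
    rewrite Rabs_R0; exact heps.
Qed.

(** * A maximum principle for the derivative of an eigenfunction *)

(** A second-derivative test that never differentiates [E * G]: just to the
    right of [t] the factor [G] is positive, so [f] increases there. *)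
Lemma not_max_of_factored_derivative (f E G : R -> R) (a b t g : R) :
  a < t < b ->
  (forall x, a < x < b -> 0 < E x /\ is_derive f x (E x * G x)) ->
  G t = 0 -> is_derive G t g -> 0 < g ->
  exists x, a < x < b /\ f t < f x.
Proof.
  intros ht hf hG0 hG hg.
  apply is_derive_Reals in hG.
  destruct (hG g hg) as [del hdel].
  set (d := Rmin (del / 2) ((b - t) / 2)).
  pose proof (cond_pos del) as hdp.
  assert (hd : 0 < d) by (apply Rmin_glb_lt; lra).
  assert (hd1 : d <= del / 2) by apply Rmin_l.
  assert (hd2 : d <= (b - t) / 2) by apply Rmin_r.
  exists (t + d); split; [lra |].
  destruct (MVT_cor2 f (fun x => E x * G x) t (t + d)) as [c [hc1 hc2]]; [lra | |].
  { intros x hx; apply is_derive_Reals, hf; lra. }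
  destruct (hf c ltac:(lra)) as [hE _].
  assert (hq : Rabs ((G (t + (c - t)) - G t) / (c - t) - g) < g).
  { apply hdel; [lra |]. rewrite Rabs_pos_eq; lra. }
  replace (t + (c - t)) with c in hq by ring.
  rewrite hG0, Rminus_0_r in hq.
  apply Rabs_def2 in hq.
  assert (hGc : 0 < G c).
  { replace (G c) with (G c / (c - t) * (c - t)) by (field; lra).
    apply Rmult_lt_0_compat; lra. }
  assert (0 < E c * G c * (t + d - t)).
  { repeat apply Rmult_lt_0_compat; lra. }
  lra.
Qed.

(** At a positive maximum of [phi1 * exp (- H)] the first-order condition is
    [phi2 = h * phi1], and there the second derivative is, up to a positive
    factor, [- phi1] times the left-hand side of the Riccati inequality, hence
    positive.  The second derivative of [phi1] is never formed: the equation
    replaces [phi2] by [a * phi1 - lambda * phi]. *)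
Lemma derivative_nonpos_of_riccati
    (D lambda : R) (phi phi1 phi2 a a' H h h' : R -> R) :
  0 < D ->
  (forall t, interval D t ->
     D_in phi phi1 (interval D) t /\ D_in phi1 phi2 (interval D) t /\
     phi2 t - a t * phi1 t = - lambda * phi t) ->
  phi1 (- D / 2) = 0 -> phi1 (D / 2) = 0 ->
  (forall t, interval D t ->
     is_derive a t (a' t) /\ is_derive H t (h t) /\ is_derive h t (h' t)) ->
  (forall t, interval D t -> h' t + h t ^ 2 - a t * h t - a' t + lambda < 0) ->
  forall t, interval D t -> phi1 t <= 0.
Proof.
  intros hD hphi hl hr hder hric t1 ht1.
  apply Rnot_lt_le; intros hpos.
  set (F := fun t => phi1 (clamp D t) * exp (- H t)).
  assert (hFeq : forall t, interval D t -> F t = phi1 t * exp (- H t)).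
  { intros t ht; unfold F; rewrite (clamp_id D t ht); reflexivity. }
  destruct (continuity_ab_maj F (- D / 2) (D / 2)) as [t0 [hmax ht0]]; [lra | |].
  { intros t ht; apply continuity_pt_mult.
    - apply (D_in_continuity_clamp D phi1 phi2 t ht), hphi, ht.
    - apply continuity_pt_filterlim.
      apply (ex_derive_continuous (fun x => exp (- H x))).
      destruct (hder t ht) as [_ [hH _]].
      auto_derive; exists (h t); exact hH. }
  assert (hF0 : 0 < F t0).
  { apply Rlt_le_trans with (F t1); [| apply hmax, ht1].
    rewrite (hFeq t1 ht1); apply Rmult_lt_0_compat; [exact hpos | apply exp_pos]. }
  rewrite (hFeq t0 ht0) in hF0.
  assert (hp0 : 0 < phi1 t0).
  { apply Rmult_lt_reg_r with (exp (- H t0)); [apply exp_pos | lra]. }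
  assert (hint : - D / 2 < t0 < D / 2).
  { destruct ht0 as [[h1 | h1] [h2 | h2]]; split; try assumption; exfalso;
      (rewrite <- h1, hl in hp0 || rewrite h2, hr in hp0); lra. }
  (* [G] is [phi2 - h * phi1] with [phi2] eliminated by the equation, which
     makes it differentiable. *)
  set (f := fun t => phi1 t * exp (- H t)).
  set (G := fun t => (a t - h t) * phi1 t - lambda * phi t).
  assert (hf : forall x, - D / 2 < x < D / 2 ->
            0 < exp (- H x) /\ is_derive f x (exp (- H x) * G x)).
  { intros x hx; split; [apply exp_pos |].
    assert (hxi : interval D x) by (unfold interval; lra).
    destruct (hphi x hxi) as [_ [hp heq]].
    apply (D_in_is_derive D _ _ x hx) in hp.
    destruct (hder x hxi) as [_ [hH _]].
    unfold f; auto_derive.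
    - repeat split; [exists (phi2 x); exact hp | exists (h x); exact hH].
    - rewrite (is_derive_unique (fun y : R => phi1 y) _ _ hp),
        (is_derive_unique (fun y : R => H y) _ _ hH).
      unfold G; replace (phi2 x) with (a x * phi1 x - lambda * phi x) by lra.
      ring. }
  destruct (hphi t0 ht0) as [hp [hp1 heq]].
  apply (D_in_is_derive D _ _ t0 hint) in hp.
  apply (D_in_is_derive D _ _ t0 hint) in hp1.
  destruct (hder t0 ht0) as [ha [hH hh]].
  assert (hG0 : G t0 = 0).
  { assert (hz : exp (- H t0) * G t0 = 0).
    { destruct (hf t0 hint) as [_ hf0].
      apply is_derive_Reals in hf0.
      pose (pr := exist _ _ hf0 : derivable_pt f t0).
      change (derive_pt f t0 pr = 0).
      apply (deriv_maximum f (- D / 2) (D / 2)); try lra.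
      intros x h1 h2.
      assert (hx : interval D x) by (unfold interval; lra).
      pose proof (hmax x hx) as hm; rewrite (hFeq x hx), (hFeq t0 ht0) in hm.
      exact hm. }
    pose proof (exp_pos (- H t0)).
    apply Rmult_integral in hz; destruct hz; [lra | assumption]. }
  assert (hp2 : phi2 t0 = h t0 * phi1 t0) by (unfold G in hG0; lra).
  destruct (not_max_of_factored_derivative f (fun x => exp (- H x)) G
              (- D / 2) (D / 2) t0
              (- phi1 t0 * (h' t0 + h t0 ^ 2 - a t0 * h t0 - a' t0 + lambda))
              hint hf hG0) as [x [hx hlt]].
  - unfold G; auto_derive.
    + repeat split; eexists; eassumption.
    + rewrite (is_derive_unique (fun y : R => phi y) _ _ hp),
        (is_derive_unique (fun y : R => phi1 y) _ _ hp1),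
        (is_derive_unique (fun y : R => a y) _ _ ha),
        (is_derive_unique (fun y : R => h y) _ _ hh), hp2.
      ring.
  - specialize (hric t0 ht0). nra.
  - assert (hxi : interval D x) by (unfold interval; lra).
    pose proof (hmax x hxi) as hm; rewrite (hFeq x hxi), (hFeq t0 ht0) in hm.
    unfold f in hlt; lra.
Qed.

(** * The supersolution and the resulting eigenvalue bound *)

(** The square makes this a primitive of the tangent wherever the cosine is
    nonzero, whatever its sign. *)
Lemma is_derive_ln_cos (w t : R) :
  cos (w * t) <> 0 ->
  is_derive (fun x => - ln (cos (w * x) ^ 2) / 2) t (w * tan (w * t)).
Proof.
  intros hc.
  assert (0 < cos (w * t) ^ 2) by (apply pow2_gt_0; exact hc).
  auto_derive; [exact H |].
  unfold tan; field; exact hc.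
Qed.

Lemma is_derive_scaled_tan (w t : R) :
  cos (w * t) <> 0 ->
  is_derive (fun x => w * tan (w * x)) t (w ^ 2 + (w * tan (w * t)) ^ 2).
Proof.
  intros hc; unfold tan.
  auto_derive; [exact hc |].
  field; exact hc.
Qed.

(** The supersolution is [exp H = exp ((1 - s) * A) * cos (w t) ^ r]; taking
    [w < PI / D] keeps the cosine positive up to the end points. *)
Lemma neumann_eigenvalue_ge
    (D lambda s c w : R) (phi phi1 phi2 A a a' : R -> R) :
  0 < D -> 0 < s < 1 -> 0 < w < PI / D -> lambda <> 0 ->
  (forall t, interval D t ->
     D_in phi phi1 (interval D) t /\ D_in phi1 phi2 (interval D) t /\
     phi2 t - a t * phi1 t = - lambda * phi t) ->
  phi1 (- D / 2) = 0 -> phi1 (D / 2) = 0 ->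
  (exists t, interval D t /\ phi t <> 0) ->
  (forall t, interval D t ->
     is_derive A t (a t) /\ is_derive a t (a' t) /\ c <= a' t) ->
  4 * s * (1 - s) * w ^ 2 + s * c <= lambda.
Proof.
  intros hD hs hw hl0 hphi hl hr [t1 [ht1 hne]] hA.
  apply Rnot_lt_le; intros hlt.
  set (r := 4 * s * (1 - s)).
  set (H := fun t => (1 - s) * A t - r * (- ln (cos (w * t) ^ 2) / 2)).
  set (h := fun t => (1 - s) * a t - r * (w * tan (w * t))).
  set (h' := fun t => (1 - s) * a' t - r * (w ^ 2 + (w * tan (w * t)) ^ 2)).
  assert (hcos : forall t, interval D t -> cos (w * t) <> 0).
  { intros t [h1 h2].
    assert (w * D < PI).
    { replace PI with (PI / D * D) by (field; lra).
      apply Rmult_lt_compat_r; lra. }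
    apply Rgt_not_eq, cos_gt_0; nra. }
  assert (hder : forall t, interval D t ->
     is_derive a t (a' t) /\ is_derive H t (h t) /\ is_derive h t (h' t)).
  { intros t ht; destruct (hA t ht) as [hAt [hat _]].
    split; [exact hat | split].
    - apply (is_derive_minus (fun x => (1 - s) * A x)).
      + apply is_derive_scal, hAt.
      + apply is_derive_scal, is_derive_ln_cos, hcos, ht.
    - apply (is_derive_minus (fun x => (1 - s) * a x)).
      + apply is_derive_scal, hat.
      + apply is_derive_scal, is_derive_scaled_tan, hcos, ht. }
  assert (hric : forall t, interval D t ->
     h' t + h t ^ 2 - a t * h t - a' t + lambda < 0).
  { intros t ht; destruct (hA t ht) as [_ [_ hc]].
    unfold h', h; set (x := w * tan (w * t)).
    (* The perfect square that dictates [r = 4 * s * (1 - s)]. *)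
    replace (_ + lambda) with
      (lambda - s * a' t - r * w ^ 2
       - s * (1 - s) * (a t + 2 * (1 - 2 * s) * x) ^ 2)
      by (unfold r; ring).
    assert (s * c <= s * a' t) by (apply Rmult_le_compat_l; lra).
    assert (0 <= s * (1 - s) * (a t + 2 * (1 - 2 * s) * x) ^ 2).
    { apply Rmult_le_pos; [nra | apply pow2_ge_0]. }
    unfold r; lra. }
  assert (hneg := derivative_nonpos_of_riccati D lambda phi phi1 phi2 a a' H h h'
                    hD hphi hl hr hder hric).
  assert (hpos := derivative_nonpos_of_riccati D lambda
                    (fun t => - phi t) (fun t => - phi1 t) (fun t => - phi2 t)
                    a a' H h h' hD).
  assert (hzero : forall t, interval D t -> phi1 t = 0).
  { intros t ht; apply Rle_antisym; [apply hneg, ht |].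
    apply Ropp_le_cancel; rewrite Ropp_0.
    refine (hpos _ _ _ hder hric t ht); [| lra | lra].
    intros u hu; destruct (hphi u hu) as [h1 [h2 h3]].
    repeat split; [apply Dopp, h1 | apply Dopp, h2 | lra]. }
  destruct (hphi t1 ht1) as [_ [hp heq]].
  rewrite (hzero t1 ht1), (D_in_zero D phi1 phi2 t1 hD ht1 hzero hp) in heq.
  assert (lambda * phi t1 <> 0) by (apply Rmult_integral_contrapositive; auto).
  lra.
Qed.

(** * The drift built from [T] *)

Lemma T_tan (k t : R) : 0 <= k -> T k t = sqrt k * tan (sqrt k * t).
Proof.
  intros hk; unfold T; destruct (Rlt_dec 0 k) as [_ | hn]; [reflexivity |].
  replace k with 0 by lra; rewrite sqrt_0; ring.
Qed.

(** The coefficient [q] is inside the derivatives because for [m = 1] the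
    coefficient of [T k2] vanishes while [T k2] itself may have poles in the
    interval. *)
Lemma T_derivatives (q k t : R) :
  0 <= k -> (q <> 0 -> T_finite k t) ->
  is_derive (fun x => q * (- ln (cos (sqrt k * x) ^ 2) / 2)) t (q * T k t) /\
  is_derive (fun x => q * T k x) t (q * (k + T k t ^ 2)).
Proof.
  intros hk hf; destruct (Req_dec q 0) as [-> | hq].
  - split; (eapply is_derive_ext; [intros x; symmetry; apply Rmult_0_l |]);
      rewrite Rmult_0_l; apply (@is_derive_const R_AbsRing).
  - assert (hc : cos (sqrt k * t) <> 0).
    { destruct (Rlt_dec 0 k) as [hp | hn]; [exact (hf hq hp) |].
      replace k with 0 by lra; rewrite sqrt_0, Rmult_0_l, cos_0; lra. }
    rewrite (T_tan k t hk); split.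
    + apply is_derive_scal, is_derive_ln_cos, hc.
    + apply is_derive_ext with (fun x => q * (sqrt k * tan (sqrt k * x))).
      { intros x; rewrite (T_tan k x hk); reflexivity. }
      apply is_derive_scal.
      pose proof (is_derive_scaled_tan (sqrt k) t hc) as d.
      rewrite (pow2_sqrt k hk) in d; exact d.
Qed.

(** * The lower bound *)

Theorem proposition1p1 (m : nat) (k1 k2 D mu : R)
  (hm : (1 <= m)%nat) (hk1 : 0 <= k1) (hk2 : 0 <= k2) (hD : 0 < D)
  (hfin : drift_finite m k1 k2 D)
  (hmu : first_nonzero_neumann_eigenvalue m k1 k2 D mu) :
  Rbar_le
    (Lub_Rbar (fun x : R => exists s : R, 0 < s < 1 /\
       x = 4 * s * (1 - s) * (PI ^ 2 / D ^ 2)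
           + 2 * s * (INR m - 1) * k2 + 4 * s * k1))
    (Finite mu).
Proof.
  apply Lub_Rbar_correct; intros x [s [hs ->]]; simpl.
  destruct hmu as [[hmu0 [phi [phi1 [phi2 [hphi [hl [hr hne]]]]]]] _].
  set (q := 2 * (INR m - 1)).
  assert (hq0 : 0 <= q).
  { apply le_INR in hm; simpl in hm; unfold q; lra. }
  assert (hdrift : forall t, interval D t ->
     is_derive (fun x => q * (- ln (cos (sqrt k2 * x) ^ 2) / 2)
                  + 1 * (- ln (cos (sqrt (4 * k1) * x) ^ 2) / 2))
       t (drift m k1 k2 t) /\
     is_derive (drift m k1 k2) t
       (q * (k2 + T k2 t ^ 2) + 1 * (4 * k1 + T (4 * k1) t ^ 2)) /\
     q * k2 + 4 * k1 <= q * (k2 + T k2 t ^ 2) + 1 * (4 * k1 + T (4 * k1) t ^ 2)).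
  { intros t ht; destruct (hfin t ht) as [hf2 hf1].
    destruct (T_derivatives q k2 t hk2) as [d1 d2].
    { intros hq; apply hf2; destruct (Nat.eq_dec m 1) as [-> | h]; [| lia].
      exfalso; apply hq; unfold q; simpl; ring. }
    destruct (T_derivatives 1 (4 * k1) t) as [e1 e2]; [lra | auto |].
    assert (hdr : forall u, q * T k2 u + 1 * T (4 * k1) u = drift m k1 k2 u).
    { intros u; unfold drift, q; ring. }
    split; [| split].
    - rewrite <- hdr; apply (is_derive_plus _ _ _ _ _ d1 e1).
    - apply (is_derive_ext _ _ _ _ hdr), (is_derive_plus _ _ _ _ _ d2 e2).
    - pose proof (pow2_ge_0 (T (4 * k1) t)).
      pose proof (Rmult_le_pos _ _ hq0 (pow2_ge_0 (T k2 t))). lra. }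
  assert (hbound : forall w, 0 < w < PI / D ->
            4 * s * (1 - s) * w ^ 2 + s * (q * k2 + 4 * k1) <= mu).
  { intros w hw.
    exact (neumann_eigenvalue_ge D mu s _ w phi phi1 phi2 _ _ _
             hD hs hw hmu0 hphi hl hr hne hdrift). }
  set (B := PI / D) in *.
  assert (hB : 0 < B) by (apply Rdiv_lt_0_compat; [apply PI_RGT_0 | exact hD]).
  replace (_ + 4 * s * k1) with
    (4 * s * (1 - s) * B ^ 2 + s * (q * k2 + 4 * k1))
    by (unfold B, q; field; lra).
  (* The values [w = B * (1 - / (INR n + 2))] lie strictly between 0 and [B]
     and tend to [B]. *)
  apply (is_lim_seq_le
    (fun n => 4 * s * (1 - s) * (B * (1 - / (INR n + 2))) ^ 2
              + s * (q * k2 + 4 * k1)) (fun _ => mu)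
    (4 * s * (1 - s) * B ^ 2 + s * (q * k2 + 4 * k1)) mu).
  - intros n; apply hbound.
    pose proof (pos_INR n).
    assert (0 < / (INR n + 2)) by (apply Rinv_0_lt_compat; lra).
    assert (/ (INR n + 2) < 1).
    { rewrite <- Rinv_1; apply Rinv_lt_contravar; lra. }
    split; nra.
  - assert (hlim : is_lim_seq (fun n => / (INR n + 2)) 0).
    { apply (is_lim_seq_inv _ p_infty); [| discriminate].
      eapply is_lim_seq_plus; [apply is_lim_seq_INR | apply is_lim_seq_const |].
      reflexivity. }
    apply (is_lim_seq_continuous
      (fun y => 4 * s * (1 - s) * (B * (1 - y)) ^ 2 + s * (q * k2 + 4 * k1)) _ 0)
      in hlim; [| apply derivable_continuous_pt; reg].
    rewrite Rminus_0_r, Rmult_1_r in hlim; exact hlim.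
  - apply is_lim_seq_const.
Qed.
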